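(* Let $f$ and $g$ be $C^1$ functions defined on a neighborhood of a point $x_0\in\mathbb{R}$, and let $w$ be a kernel function satisfying the Normalization Constraint with parameter $W>0$ (for each $W>0$). Then the Tao Derivative of the product $f\cdot g$ at $x_0$, $$(f\cdot g)'_{\mathrm{TD}}(x_0;w)=\lim_{W\to 0}\frac{\int_0^W f(x_0+t)g(x_0+t)\,w(t)\,dt-\int_0^W f(x_0-t)g(x_0-t)\,w(t)\,dt}{2\int_0^W t\,w(t)\,dt},$$ exists and equals $f'(x_0)g(x_0)+g'(x_0)f(x_0)$.
   Context: Normalization Constraint: for a parameter $W>0$, a (Lebesgue integrable) function $w:\mathbb{R}\to\mathbb{R}$ satisfies the Normalization Constraint with parameter $W$ if $\int_0^W w(t)\,dt=1$, $w(t)>0$ for $t\in(0,W]$, and $w(t)=0$ for $t\in(-\infty,0]\cup(W,\infty)$. The kernel $w$ depends on $W$ (one kernel for each $W>0$), and the limit $W\to 0$ is taken over this family. *)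

(* Defs.v *)
From HB Require Import structures.
From mathcomp Require Import all_boot all_order all_algebra.
From mathcomp Require Import all_classical all_reals all_analysis.
Set Implicit Arguments.
Unset Strict Implicit.
Unset Printing Implicit Defensive.
Import Order.TTheory GRing.Theory Num.Theory.
Import numFieldNormedType.Exports.
Local Open Scope classical_set_scope.
Local Open Scope ring_scope.

(* [f] is a total function whose values away from [x0] are irrelevant: this
   says that f is C^1 on some open neighborhood of x0. *)
Definition C1_near (R : realType) (f : R -> R) (x0 : R) : Prop :=
  \forall x \near x0, derivable f x 1 /\ {for x, continuous f^`()%classic}.

(* [lebesgue_measure] lives on the Borel sigma-algebra; its completion is used
   so that kernels may be arbitrary Lebesgue integrable functions. *)
Definition normalization_constraint (R : realType) (W : R) (w : R -> R)
    : Prop :=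
  [/\ (@completed_lebesgue_measure R).-integrable setT (EFin \o w),
      \int[@completed_lebesgue_measure R]_(t in `[0, W]) w t = 1,
      forall t, t \in `]0, W] -> 0 < w t
    & forall t, t \notin `]0, W] -> w t = 0].

(* In what follows [w] is a family of kernels: [w W] is the kernel attached to
   the parameter W. *)
Definition tao_quotient (R : realType) (w : R -> R -> R) (F : R -> R) (x0 : R)
    (W : R) : R :=
  (\int[@completed_lebesgue_measure R]_(t in `[0, W]) (F (x0 + t) * w W t)
   - \int[@completed_lebesgue_measure R]_(t in `[0, W]) (F (x0 - t) * w W t))
  / (2 * \int[@completed_lebesgue_measure R]_(t in `[0, W]) (t * w W t)).

(* Integral and division are total functions returning default values, so that
   the quotient is meaningful only under these conditions. *)
Definition tao_quotient_defined (R : realType) (w : R -> R -> R) (F : R -> R)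
    (x0 : R) (W : R) : Prop :=
  [/\ (@completed_lebesgue_measure R).-integrable `[0, W]
        (fun t => (F (x0 + t) * w W t)%:E),
      (@completed_lebesgue_measure R).-integrable `[0, W]
        (fun t => (F (x0 - t) * w W t)%:E),
      (@completed_lebesgue_measure R).-integrable `[0, W] (fun t => (t * w W t)%:E)
    & \int[@completed_lebesgue_measure R]_(t in `[0, W]) (t * w W t) != 0].

(* Existence of the limit, including that the quotient is well defined for all
   sufficiently small W > 0. *)
Definition tao_derivable (R : realType) (w : R -> R -> R) (F : R -> R)
    (x0 : R) : Prop :=
  (\forall W \near 0^'+, tao_quotient_defined w F x0 W) /\
  cvg (tao_quotient w F x0 W @[W --> 0^'+]).

Definition tao_derivative (R : realType) (w : R -> R -> R) (F : R -> R)
    (x0 : R) : R :=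
  lim (tao_quotient w F x0 W @[W --> 0^'+]).

(* Main.v *)
Require Import Defs.
From HB Require Import structures.
From mathcomp Require Import all_boot all_order all_algebra.
From mathcomp Require Import all_classical all_reals all_analysis.
From mathcomp Require Import measurable_realfun ring lra.
Set Implicit Arguments.
Unset Strict Implicit.
Unset Printing Implicit Defensive.
Import Order.TTheory GRing.Theory Num.Theory.
Import numFieldNormedType.Exports.
Local Open Scope classical_set_scope.
Local Open Scope ring_scope.

(** Only the differentiability of [F = f * g] near [x0] matters. With
    [L = F'(x0)], for [W] small one has [|F (x0 + h) - F x0 - L h| <= e |h|]
    whenever [|h| <= W], so that [F (x0 + t) - F (x0 - t)] lies between
    [2 (L - e) t] and [2 (L + e) t] for [0 <= t <= W]. Integrating against the
    nonnegative kernel puts the numerator of the Tao quotient between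
    [2 (L - e) M] and [2 (L + e) M], with [M > 0] the first moment of the
    kernel. *)

Section tao_derivative.
Context {R : realType}.
Local Notation mu := (@completed_lebesgue_measure R).
Local Notation cmeasurable := ((@wlength R idfun)^*%mu.-cara.-measurable).

Lemma measurable_completed (A : set R) :
  measurable (A : set (measurableTypeR R)) -> cmeasurable A.
Proof. exact: sub_caratheodory. Qed.

(** On a compact segment [h] is bounded. It is also Borel measurable there, hence measurable for the
    larger Caratheodory sigma-algebra of [mu]; a bounded measurable factor preserves
    integrability. *)
Lemma continuous_integrableMl (a b : R) (h k : R -> R) :
  {within `[a, b], continuous h} ->
  mu.-integrable setT (EFin \o k) ->
  mu.-integrable `[a, b] (fun t => (h t * k t)%:E).
Proof.
move=> ch ik.
have mab : cmeasurable `[a, b]%classic.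
  by apply: measurable_completed; exact: measurable_itv.
have mh : measurable_fun `[a, b] (h : measurableTypeR R -> R).
  by apply: subspace_continuous_measurable_fun => //; exact: measurable_itv.
apply: (@integrableMr _ _ _ mu _ mab h (EFin \o k)).
- move=> _ Y mY; apply: measurable_completed.
  by apply: mh => //; exact: measurable_itv.
- have /compact_bounded[M [_ mrt]] :=
    continuous_compact ch (@segment_compact _ a b).
  by exists M; split; rewrite ?num_real // => ? ? ? ?; exact: mrt.
- by apply: integrableS ik.
Qed.

Lemma first_moment_gt0 (W : R) (w : R -> R) :
  0 < W -> normalization_constraint W w ->
  mu.-integrable `[0, W] (fun t => (t * w t)%:E) /\
  0 < \int[mu]_(t in `[0, W]) (t * w t).
Proof.
(* If the moment vanished then [t * w t], hence [w], would be 0 a.e. *)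
move=> W0 [iw w1 wgt0 w0].
have itw : mu.-integrable `[0, W] (fun t => (t * w t)%:E).
  apply: (@continuous_integrableMl 0 W id) => //.
  by apply: continuous_subspaceT => x; exact: cvg_id.
have mW : cmeasurable `[0, W]%classic.
  by apply: measurable_completed; exact: measurable_itv.
have wge0 t : 0 <= w t.
  have [tW|tW] := boolP (t \in `]0, W]); first exact/ltW/wgt0.
  by rewrite w0.
have tw0 t : `[0, W]%classic t -> 0 <= t * w t.
  by rewrite /= in_itv/= => /andP[t0 _]; rewrite mulr_ge0.
split=> //; rewrite lt_neqAle Rintegral_ge0// andbT eq_sym.
apply/eqP => tw_eq0.
suff : \int[mu]_(t in `[0, W]) w t = 0.
  by rewrite w1 => /eqP; rewrite oner_eq0.
have ae0 : ae_eq mu `[0, W]%classic (fun t => (t * w t)%:E) (cst 0%E).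
  apply/(ae_eq_integral_abs mu mW); first exact: (measurable_int mu).
  transitivity (\int[mu]_(t in `[0%R, W]) (t * w t)%:E)%E.
    by apply: eq_integral => t /[!inE] tW; rewrite gee0_abs// lee_fin tw0.
  (* A real-valued integral equal to 0 could also come from an infinite one, since [fine] sends
     infinities to 0; integrability excludes this. *)
  move: tw_eq0; rewrite /Rintegral => tw_eq0.
  rewrite -[LHS]fineK ?tw_eq0//.
  exact: integrable_fin_num.
rewrite /Rintegral (@ae_eq_integral _ _ _ mu `[0, W]%classic (cst 0%E) (EFin \o w) mW)//.
- by rewrite integral0.
- by apply: measurable_int; apply: integrableS iw.
- apply: filterS ae0 => t tw tW; have [/eqP] := tw tW.
  (* At [t = 0] the product carries no information on [w], but [w 0 = 0] because 0 lies outside []0,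
     W]]. *)
  rewrite /= mulf_eq0 => /orP[|] /eqP -> //.
  by rewrite /= w0// in_itv/= ltxx.
Qed.

(** The limit of the difference quotient with the division by [h] cleared. Both sides vanish at
    [h = 0], so the punctured neighborhood becomes a full one. *)
Lemma is_derive1_approx (F : R -> R) (x0 L e : R) :
  is_derive x0 1 F L -> 0 < e ->
  \forall h \near 0, `|F (x0 + h) - F x0 - L * h| <= e * `|h|.
Proof.
move=> [dF FL] e0.
have : h^-1 *: ((F \o shift x0) (h *: 1) - F x0) @[h --> 0^'] --> L.
  by rewrite -FL; exact: dF.
move/cvgrPdist_le => /(_ e e0); rewrite near_withinE.
apply: filterS => h /= hh.
have [->|h0] := eqVneq h 0; first by rewrite addr0 subrr mulr0 subr0 normr0 mulr0.
have := hh h0; rewrite -(ler_pM2r (_ : 0 < `|h|)) ?normr_gt0// -normrM.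
suff -> : (L - h^-1 *: (F (h *: (1 : R) + x0) - F x0)) * h =
          - (F (x0 + h) - F x0 - L * h) by rewrite normrN.
by rewrite /GRing.scale/= mulr1 (addrC h); field.
Qed.

(** Derivability near [x0] makes [F] continuous on the segments integrated over, so that the
    quotient is defined for small [W]; the derivative at [x0] itself then governs the limit. *)
Lemma tao_quotient_cvg (w : R -> R -> R) (F : R -> R)
    (x0 L : R) :
  (\forall x \near x0, derivable F x 1) -> is_derive x0 1 F L ->
  (forall W, 0 < W -> normalization_constraint W (w W)) ->
  (\forall W \near 0^'+, tao_quotient_defined w F x0 W) /\
  tao_quotient w F x0 W @[W --> 0^'+] --> L.
Proof.
move=> dF FL hw.
(* Once [W] is below the radius of a ball around 0 where [P] holds, that ball contains [t] and [- t]
   for every [t] in [[0, W]]. *)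
have near_seg (P : R -> Prop) : (\forall h \near 0, P h) ->
    \forall W \near 0^'+, forall t, t \in `[0, W] -> P t /\ P (- t).
  move=> /nbhs_ballP[d /= d0 Pd]; near=> W => t; rewrite in_itv/= => /andP[t0 tW].
  have tdW : `|t| < d.
    by rewrite ger0_norm// (le_lt_trans tW)//; near: W; exact: nbhs_right_lt.
  by split; apply: Pd; rewrite /ball/= sub0r normrN ?normrN.
have defd : \forall W \near 0^'+, tao_quotient_defined w F x0 W.
  have : \forall h \near 0, derivable F (x0 + h) 1.
    by move: dF; rewrite (near_shift 0) subr0; apply: filterS => h; rewrite /= addrC.
  move=> /near_seg; apply: filterS2; last exact: nbhs_right_gt.
  move=> W W0 dFW.
  have [itw tw0] := first_moment_gt0 W0 (hw W W0).
  have [iw _ _ _] := hw W W0.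
  (* The sign [s], taken to be 1 and then -1, treats both integrands at once. *)
  have cF (s : R) : {in `[0, W], forall t, derivable F (x0 + s * t) 1} ->
      {within `[0, W], continuous (fun t => F (x0 + s * t))}.
    move=> dFs; apply: continuous_in_subspaceT => t /[!inE] /dFs.
    move=> /derivable1_diffP/differentiable_continuous cFs.
    apply: continuous_comp => //; apply: cvgD; first exact: cvg_cst.
    exact: mulrl_continuous.
  split=> //; last by rewrite gt_eqF.
  - apply: continuous_integrableMl iw.
    rewrite (_ : (fun t => F (x0 + t)) = (fun t => F (x0 + 1 * t))).
      by apply: cF => t /dFW[]; rewrite mul1r.
    by apply/funext => t; rewrite mul1r.
  - apply: continuous_integrableMl iw.
    rewrite (_ : (fun t => F (x0 - t)) = (fun t => F (x0 + -1 * t))).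
      by apply: cF => t /dFW[]; rewrite mulN1r.
    by apply/funext => t; rewrite mulN1r.
split=> //; apply/cvgrPdist_le => e e0.
near=> W.
have W0 : 0 < W by near: W; exact: nbhs_right_gt.
have [iw _ wgt0 w0] := hw W W0.
have wge0 t : 0 <= w W t.
  have [tW|tW] := boolP (t \in `]0, W]); first exact/ltW/wgt0.
  by rewrite w0.
have [iFp iFm itw _] : tao_quotient_defined w F x0 W by near: W.
have approx t : t \in `[0, W] ->
    `|F (x0 + t) - F x0 - L * t| <= e * `|t| /\
    `|F (x0 - t) - F x0 - L * - t| <= e * `|- t|.
  by move: t; near: W; apply: near_seg; exact: is_derive1_approx.
have [_] := first_moment_gt0 W0 (hw W W0).
rewrite /tao_quotient; set M := \int[mu]_(t in `[0, W]) (t * w W t) => M0.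
set A := \int[mu]_(t in `[0, W]) (F (x0 + t) * w W t).
set B := \int[mu]_(t in `[0, W]) (F (x0 - t) * w W t).
have mW : cmeasurable  `[0, W]%classic.
  by apply: measurable_completed; exact: measurable_itv.
have iD : mu.-integrable `[0, W]
    (EFin \o (fun t => F (x0 + t) * w W t - F (x0 - t) * w W t)).
  exact: (integrableB mW iFp iFm).
have iZ c : mu.-integrable `[0, W] (EFin \o (fun t => c * (t * w W t))).
  exact: (integrableZl mW c itw).
have AB : A - B = \int[mu]_(t in `[0, W]) (F (x0 + t) * w W t - F (x0 - t) * w W t).
  by rewrite RintegralB.
have ZM c : c * M = \int[mu]_(t in `[0, W]) (c * (t * w W t)).
  by rewrite RintegralZl.
(* Subtracting the two estimates of [approx] cancels [F x0] and adds the errors; multiplying by the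
   nonnegative [w W t] keeps the inequality. *)
have ub : A - B <= (2 * (L + e)) * M.
  rewrite AB ZM; apply: le_Rintegral => // t tW.
  have [t0 _] : 0 <= t /\ t <= W by move: tW; rewrite /= in_itv/= => /andP.
  have [] := approx t tW; rewrite normrN (ger0_norm t0) !ler_norml.
  move=> /andP[? ?] /andP[? ?].
  by rewrite -mulrBl mulrA ler_wpM2r//; lra.
have lb : (2 * (L - e)) * M <= A - B.
  rewrite AB ZM; apply: le_Rintegral => // t tW.
  have [t0 _] : 0 <= t /\ t <= W by move: tW; rewrite /= in_itv/= => /andP.
  have [] := approx t tW; rewrite normrN (ger0_norm t0) !ler_norml.
  move=> /andP[? ?] /andP[? ?].
  by rewrite -mulrBl mulrA ler_wpM2r//; lra.
have M20 : 0 < 2 * M by rewrite mulr_gt0.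
(* Division by [2 * M > 0] turns the two bounds into distance at most [e] from [L]. *)
rewrite distrC ler_distl ler_pdivrMr// ler_pdivlMr//.
by apply/andP; split; lra.
Unshelve. all: by end_near.
Qed.

End tao_derivative.

Theorem theorem2 (R : realType) (f g : R -> R) (x0 : R) (w : R -> R -> R)
    (hf : C1_near f x0) (hg : C1_near g x0)
    (hw : forall W : R, 0 < W -> normalization_constraint W (w W)) :
  tao_derivable w (fun x => f x * g x) x0 /\
  tao_derivative w (fun x => f x * g x) x0
    = f^`()%classic x0 * g x0 + g^`()%classic x0 * f x0.
Proof.
have [df dg] : derivable f x0 1 /\ derivable g x0 1.
  by split; [have [] := nbhs_singleton hf|have [] := nbhs_singleton hg].
(* The product rule is applied at every nearby point, since the integrands sample the product around
   [x0]. *)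
have dfg : \forall x \near x0, derivable (fun x => f x * g x) x 1.
  by apply: filterS2 hf hg => x [? _] [? _]; exact: derivableM.
have Dfg : is_derive x0 1 (fun x => f x * g x)
    (f^`()%classic x0 * g x0 + g^`()%classic x0 * f x0).
  split; first exact: nbhs_singleton dfg.
  by rewrite !derive1E (deriveM df dg) addrC /GRing.scale/= mulrC (mulrC (f x0)).
have [defd cvgL] := tao_quotient_cvg dfg Dfg hw.
split; last exact: cvg_lim cvgL.
by split=> //; exact: cvgP cvgL.
Qed.
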